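(* Let $G=P_{n_1}\square\cdots\square P_{n_d}$, where $d\ge 2$ and $n_i\ge 2$ are integers for $i=1,\ldots,d$. Then: (i) if $\prod_{i=1}^d n_i$ is even, then $G$ is RP; (ii) if $\prod_{i=1}^d n_i$ is odd, then $G$ is SRN.
   Context: $P_n$ denotes the path on $n$ vertices and $\square$ the Cartesian product of graphs, so $P_{n_1}\square\cdots\square P_{n_d}$ has vertex set $\{(a_1,\ldots,a_d):1\le a_i\le n_i\}$, with two vertices adjacent if and only if they differ by one in exactly one coordinate and agree in all others. Let $G=(V,E)$ be a finite simple connected graph with set of spanning trees $\mathcal T(G)$. For a positive conductance function $c:E\to\mathbb R_{>0}$ and an edge $uv\in E$, the relative resistance is $r_{uv}(c)=c_{uv}\,\omega_{uv}(c)$, where $\omega_{uv}(c)$ is the effective resistance between $u$ and $v$ in the electrical network in which each edge $e$ has resistance $c_e^{-1}$; equivalently, $$r_{uv}(c)=\frac{\sum_{T\in\mathcal T(G):\,uv\in E(T)}\prod_{e\in E(T)}c_e}{\sum_{T\in\mathcal T(G)}\prod_{e\in E(T)}c_e}.$$ The resistance curvature at $v\in V$ is $p_v(c)=1-\frac12\sum_{u:\,uv\in E}r_{uv}(c)$. $G$ is resistance nonnegative (RN) if there exists $c:E\to\mathbb R_{>0}$ with $p_v(c)\ge 0$ for every $v\in V$; resistance positive (RP) if there exists $c:E\to\mathbb R_{>0}$ with $p_v(c)>0$ for every $v\in V$; and strictly resistance nonnegative (SRN) if it is RN but not RP. The paper uses the following known characterization (Devriendt): $G$ is RN (respectively RP)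 if and only if there is a point $x\in P(G)^\circ$ with $\sum_{u:\,uv\in E}x_{uv}\le 2$ (respectively $<2$) for every $v\in V$, where $P(G)^\circ$ is the relative interior of the spanning tree polytope $P(G)=\operatorname{conv}\{\chi^T:T\in\mathcal T(G)\}\subseteq\mathbb R^E$. *)

(* Defs.v *)
From HB Require Import structures.
From mathcomp Require Import all_boot all_order all_algebra.
From mathcomp Require Import boolp reals.

Set Implicit Arguments.
Unset Strict Implicit.
Unset Printing Implicit Defensive.

Import Order.TTheory GRing.Theory Num.Theory.
Local Open Scope ring_scope.

(* A finite simple graph is a symmetric irreflexive [e : rel T] on a finType;
   the edge {u, v} is the two-element set [set u; v]. *)
Section Graphs.
Variables (T : finType) (e : rel T).

Definition edges : {set {set T}} :=
  [set [set p.1; p.2] | p in [pred p : T * T | e p.1 p.2]].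

Definition adj_in (S : {set {set T}}) : rel T := [rel x y | [set x; y] \in S].

Definition connected_by (S : {set {set T}}) : Prop :=
  forall x y : T, connect (adj_in S) x y.

(* [ucycle] also accepts back-and-forth walks [:: x; y] along one edge, so
   graph cycles are those with at least three vertices. *)
Definition acyclic (S : {set {set T}}) : Prop :=
  forall p : seq T, (2 < size p)%N -> ~ ucycle (adj_in S) p.

Definition spanning_tree (S : {set {set T}}) : Prop :=
  [/\ S \subset edges, connected_by S & acyclic S].

Definition spanning_trees : {set {set {set T}}} :=
  [set S | `[< spanning_tree S >]].

End Graphs.

Section ResistanceCurvature.
Variables (R : realType) (T : finType) (e : rel T).

(* Conductances are total functions on {set T}; only the values on [edges e]
   are ever used. *)
Definition conductance (c : {set T} -> R) : Prop :=
  forall f, f \in edges e -> 0 < c f.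

Definition tree_weight (c : {set T} -> R) (S : {set {set T}}) : R :=
  \prod_(f in S) c f.

(* c_uv times the effective resistance between u and v, in Kirchhoff's form:
   the weighted proportion of spanning trees that contain the edge uv. *)
Definition relative_resistance (c : {set T} -> R) (u v : T) : R :=
  (\sum_(S in spanning_trees e | [set u; v] \in S) tree_weight c S)
  / (\sum_(S in spanning_trees e) tree_weight c S).

Definition resistance_curvature (c : {set T} -> R) (v : T) : R :=
  1 - 2^-1 * \sum_(u | e u v) relative_resistance c u v.

Definition resistance_nonnegative : Prop :=
  exists c : {set T} -> R,
    conductance c /\ forall v, 0 <= resistance_curvature c v.

Definition resistance_positive : Prop :=
  exists c : {set T} -> R,
    conductance c /\ forall v, 0 < resistance_curvature c v.

Definition strictly_resistance_nonnegative : Prop :=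
  resistance_nonnegative /\ ~ resistance_positive.

End ResistanceCurvature.

Definition path_graph (m : nat) : rel 'I_m :=
  [rel x y : 'I_m | (x.+1 == y :> nat) || (y.+1 == x :> nat)].
Arguments path_graph m : clear implicits.

Definition cartesian_product (I : finType) (V : I -> finType)
    (e : forall i, rel (V i)) : rel {dffun forall i : I, V i} :=
  [rel a b : {dffun forall i : I, V i} |
    [exists i, e i (a i) (b i) &&
               [forall j, (j != i) ==> (a j == b j)]]].

(* Coordinates run over 0, ..., n i - 1 instead of 1, ..., n i. *)
Definition grid (d : nat) (n : 'I_d -> nat) :
    rel {dffun forall i : 'I_d, 'I_(n i)} :=
  cartesian_product (fun i => path_graph (n i)).
Arguments grid {d} n.

Lemma path_graph_sym m : symmetric (path_graph m).
Proof. by move=> x y; rewrite /path_graph /= orbC. Qed.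

Lemma path_graph_irrefl m : irreflexive (path_graph m).
Proof. by move=> x; rewrite /path_graph /= orbb; apply/negbTE; rewrite gtn_eqF. Qed.

Lemma grid_sym d (n : 'I_d -> nat) : symmetric (grid n).
Proof.
move=> a b; apply/existsP/existsP => -[i /andP[ab /forallP h]]; exists i.
all: rewrite path_graph_sym ab /=; apply/forallP => j.
all: by rewrite [X in _ ==> X]eq_sym; exact: h.
Qed.

Lemma grid_irrefl d (n : 'I_d -> nat) : irreflexive (grid n).
Proof.
by move=> a; apply/negbTE/existsPn => i; rewrite path_graph_irrefl.
Qed.

(* Main.v *)
From mathcomp Require Import classical_sets topology normedtype derive.
From mathcomp Require Import sequences exp.
Require Import Defs.
From mathcomp Require Import all_boot all_order all_algebra.
From mathcomp Require Import boolp reals.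
From mathcomp Require Import zify ring lra.

Set Implicit Arguments.
Unset Strict Implicit.
Unset Printing Implicit Defensive.

Import Order.TTheory GRing.Theory Num.Theory numFieldNormedType.Exports.

(** Conductances of the form [c {x, y} = exp (theta x + theta y)] are enough.
    With them a spanning tree [S] has weight
    [exp (\sum_x theta x * (deg_S x - 2))] up to a factor common to all trees,
    and the curvature at [x] is, up to a positive factor, minus the partial
    derivative at [x] of the convex function
    [Z theta = \sum_S exp (\sum_x theta x * (deg_S x - 2))].  So a minimiser of
    [Z] plus a small linear term, over all [theta] with [theta x <= 0] off a
    set [F], has positive curvature off [F] and zero curvature on [F], provided
    that it exists.  On a box it does; what remains is to see that the box
    imposes no active constraint of its own ([exp_sum_equilibrium]), that is,
    that upper bounds on all the exponents [\sum_x theta x * (deg_S x - 2)]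
    bound [theta] itself (modulo constants on [F]).

    These bounds come from explicit trees.  The boustrophedon order of the grid
    is a Hamiltonian path [v 0, v 1, ...] folded into rows, where consecutive
    rows are joined by chords.  Adding a chord between [v i] and [v j] to the
    path and deleting the edge from [v l] to [v l.+1] that lies between them
    gives a spanning tree, whose exponent bounds
    [theta (v i) + theta (v j) - theta (v l) - theta (v l.+1)].  When [l] is
    next to one end of the chord, this is a single comparison
    [theta p <= theta q + constant] between positions of the same parity, and
    such comparisons propagate a lower bound from the ends of the path to all
    positions whose parity is that of an end ([even_bounded]).

    If the number of vertices is even, the two ends have both parities, every
    [theta x] is bounded, and [F] can be empty: the grid is RP.  If it is odd,
    both ends are even and [F] consists of the odd positions, one colour class
    of the bipartite grid; the full strength of the exchange inequalities
    bounds the differences of [theta] on [F] ([odd_dominated]), so the grid is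
    RN.  It is not RP, because every edge of a spanning tree has exactly one
    end in [F] and the tree has [2 * #|F|] edges, so that the curvatures over
    [F] sum to zero ([snake_not_positive]). *)

(** * Spanning trees and their number of edges *)

Section SpanningTrees.
Variables (T : finType).
Implicit Types (S : {set {set T}}) (x y : T).

Lemma adj_in_sym S : symmetric (adj_in S).
Proof. by move=> x y; rewrite /adj_in /= setUC. Qed.

Lemma connect_adj_sym S : connect_sym (adj_in S).
Proof. exact/sym_connect_sym/adj_in_sym. Qed.

Lemma connect_adjS S S' x y :
  S \subset S' -> connect (adj_in S) x y -> connect (adj_in S') x y.
Proof.
by move=> sub; apply: connect_sub => a b /(subsetP sub) ab; apply: connect1.
Qed.

Lemma mem_edges (e : rel T) x y : e x y -> [set x; y] \in edges e.
Proof. by move=> xy; apply/imsetP; exists (x, y). Qed.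

Lemma edgesP (e : rel T) (f : {set T}) :
  reflect (exists2 p : T * T, e p.1 p.2 & f = [set p.1; p.2]) (f \in edges e).
Proof.
by apply: (iffP imsetP) => -[p ep ->]; exists p.
Qed.

(** Grow a connected set of vertices from a root, one crossing edge at a
    time: each new vertex costs exactly one edge. *)
Lemma spanning_subtree S (x0 : T) : connected_by S ->
  exists2 S' : {set {set T}}, S' \subset S & connected_by S' /\ #|S'|.+1 = #|T|.
Proof.
move=> conn.
suff grow k : k < #|T| -> exists (X : {set T}) (S' : {set {set T}}),
    [/\ #|X| = k.+1, #|S'| = k, S' \subset S,
        forall f, f \in S' -> f \subset X
      & forall x, x \in X -> connect (adj_in S') x0 x].
  have T_gt0 : 0 < #|T| by apply/card_gt0P; exists x0.
  case: (grow #|T|.-1) => [|X [S' [cX cS sS _ cn]]]; first by lia.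
  have XT x : x \in X.
    have /setP/(_ x) : X = setT.
      by apply/eqP; rewrite eqEcard subsetT cardsT; lia.
    by rewrite inE.
  exists S' => //; split; last by rewrite cS; lia.
  move=> x y; apply: (connect_trans (y := x0)); last exact: cn.
  by rewrite connect_adj_sym; exact: cn.
elim: k => [|k IHk] kT.
  exists [set x0], set0; split; rewrite ?cards1 ?cards0 ?sub0set //.
    by move=> f; rewrite inE.
  by move=> x /set1P->; apply: connect0.
have [X [S' [cX cS sS in_X cn]]] := IHk (ltnW kT).
have [/existsP[a /andP[aX /existsP[b /andP[bX abS]]]]|no] :=
  boolP [exists a, (a \in X) && [exists b, (b \notin X) && ([set a; b] \in S)]].
  have abS' : [set a; b] \notin S'.
    by apply: contraNN bX => /in_X /subsetP; apply; rewrite !inE eqxx orbT.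
  have subS : S' \subset [set a; b] |: S' by apply: subsetUr.
  exists (b |: X), ([set a; b] |: S'); split.
  - by rewrite cardsU1 bX cX.
  - by rewrite cardsU1 abS' cS.
  - by rewrite subUset sS sub1set abS.
  - move=> f /setU1P[->|/in_X fX]; last exact: subset_trans fX (subsetUr _ _).
    by rewrite subUset !sub1set !inE aX eqxx orbT.
  - move=> x /setU1P[->|/cn xX]; last exact: connect_adjS xX.
    apply: (connect_trans (connect_adjS subS (cn _ aX))).
    by apply: connect1; rewrite /adj_in /= setU11.
have clX : closed (adj_in S) (mem X).
  apply: intro_closed; first exact: connect_adj_sym.
  move=> a b ab aX; apply: contraNT no => bX.
  apply/existsP; exists a; apply/andP; split=> //.
  by apply/existsP; exists b; rewrite bX.
have x0X : x0 \in X.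
  have [a aX] : exists a, a \in X by apply/set0Pn; rewrite -card_gt0 cX.
  by rewrite (closed_connect clX (conn x0 a)).
have: #|T| <= #|X|.
  apply: subset_leq_card; apply/subsetP => y _.
  by rewrite -(closed_connect clX (conn x0 y)).
by rewrite cX; lia.
Qed.

Lemma connected_card S (x0 : T) : connected_by S -> #|T| <= #|S|.+1.
Proof.
by move=> /(spanning_subtree x0)[S' /subset_leq_card sS [_ <-]]; rewrite ltnS.
Qed.

(** An edge outside a connected set of edges closes a simple path of it into
    a cycle, so an acyclic set has no connected proper subset. *)
Lemma spanning_tree_card (e : rel T) S (x0 : T) : irreflexive e ->
  spanning_tree e S -> #|S|.+1 = #|T|.
Proof.
move=> irr [Se conn acyc].
have [S' sS [conn' <-]] := spanning_subtree x0 conn.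
suff -> : S = S' by [].
apply/eqP; rewrite eqEsubset sS andbT; apply/subsetP => f fS.
apply: contraT => fS'; have /edgesP[[a b] /= ab fE] := subsetP Se _ fS.
have aNb : a != b by apply: contraTneq ab => ->; rewrite irr.
have /connectP[p pth lst] := conn' a b.
case/shortenP: pth lst => q pth uq _ lst.
case: (acyc (a :: q)).
  case: q pth uq lst => [|c [|d q]] //= pth _ lst; first by rewrite lst eqxx in aNb.
  by move: pth; rewrite -lst /adj_in /= -fE (negbTE fS').
apply/andP; split=> //; rewrite /cycle rcons_path -lst adj_in_sym.
rewrite {2}/adj_in /= -fE fS andbT.
by apply: sub_path pth => u v /(subsetP sS).
Qed.

(** A cycle could lose an edge without disconnecting anything, and then too
    few edges would remain. *)
Lemma spanning_tree_of_card (e : rel T) S (x0 : T) : S \subset edges e ->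
  connected_by S -> #|S| < #|T| -> spanning_tree e S.
Proof.
move=> Se conn cS; split=> // -[|x [|y [|z p]]] // _ /andP[cyc uq].
have {cyc} [xy yz zx] : [/\ adj_in S x y, adj_in S y z &
    path (adj_in S) z (rcons p x)] by move: cyc => /= /and3P[].
have [xNy xNz yNz] : [/\ x != y, x != z & y != z].
  move: uq => /= /and3P[]; rewrite !inE !negb_or => /and3P[-> -> _].
  by case/andP=> ->.
have yNp : y \notin z :: rcons p x.
  move: uq => /= /and3P[_ yNp _]; move: yNp.
  by rewrite !inE mem_rcons inE !negb_or (eq_sym y x) xNy => /andP[-> ->].
set S1 := S :\ [set x; y].
have sub1 : S1 \subset S by apply: subD1set.
have yx1 : connect (adj_in S1) y x.
  apply: (connect_trans (y := z)).
    apply: connect1; rewrite /adj_in /= in_setD1 [_ \in S]yz andbT.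
    apply: contraNneq xNz => /setP/(_ z).
    by rewrite !inE eqxx orbT !(eq_sym z) (negbTE yNz) orbF => <-.
  apply/connectP; exists (rcons p x); last by rewrite last_rcons.
  apply: (sub_in_path (P := [pred u | u != y])) zx => [u v uy vy uv|].
    rewrite /adj_in /= in_setD1 [_ \in S]uv andbT.
    apply: contraNneq uy => /setP/(_ y).
    by rewrite !inE eqxx orbT !(eq_sym y) (negbTE (vy : v != y)) orbF.
  by apply/allP => u uz; apply: contraNneq yNp => <-.
have conn1 : connected_by S1.
  move=> a b; apply: connect_sub (conn a b) => u v uv.
  have [uvE|uvN] := eqVneq [set u; v] [set x; y]; last first.
    by apply: connect1; rewrite /adj_in /= in_setD1 uvN.
  have := set21 u v; have := set22 u v.
  rewrite uvE !inE => /orP[]/eqP-> /orP[]/eqP->; rewrite ?connect0 //.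
  by rewrite connect_adj_sym.
have := connected_card x0 conn1; have := cardsD1 [set x; y] S.
by rewrite -/S1 (xy : _ \in S) add1n => SE le; move: (leq_trans cS le); rewrite SE ltnn.
Qed.

End SpanningTrees.

(** * Minimising a sum of exponentials over a box *)

Section BoxMinimum.
Local Open Scope ring_scope.
Local Open Scope classical_set_scope.
Variables (R : realType) (I V : finType) (P : {set I}) (u : I -> V -> R).

(** The tangent at a nearby point [t > 0] lies below the convex function, so
    its slope there is nonnegative; the slope is continuous in [t]. *)
Lemma exp_sum_right_min (s d : I -> R) (a t0 : R) : 0 < t0 ->
  (forall t, 0 < t -> t < t0 ->
     \sum_(i in P) expR (s i) <= \sum_(i in P) expR (s i + t * d i) + t * a) ->
  0 <= \sum_(i in P) expR (s i) * d i + a.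
Proof.
move=> t0_gt0 min0.
pose g t : R := \sum_(i in P) expR (s i + t * d i) * d i + a.
have -> : \sum_(i in P) expR (s i) * d i + a = g 0.
  by congr (_ + _); apply: eq_bigr => i _; rewrite mul0r addr0.
have g_ge0 t : 0 < t -> t < t0 -> 0 <= g t.
  move=> t_gt0 tt0; rewrite -(pmulr_rge0 _ t_gt0) mulrDr mulr_sumr.
  have tangent i : i \in P -> expR (s i + t * d i) - expR (s i) <=
      t * (expR (s i + t * d i) * d i).
    move=> _; have := expR_ge1Dx (- (t * d i)).
    rewrite -(ler_pM2l (expR_gt0 (s i + t * d i))) -expRD addrK.
    by rewrite mulrDr mulr1; lra.
  have := ler_sum (index_enum I) tangent; rewrite sumrB.
  by have := min0 t t_gt0 tt0; lra.
have g_cont : continuous g.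
  move=> t; apply: cvgD; last exact: cvg_cst.
  apply: (@continuous_big _ _ +%R 0); first exact: add_continuous.
  move=> i _ {}t; apply: cvgM; last exact: cvg_cst.
  apply: continuous_comp; last exact: continuous_expR.
  by apply: cvgD; [exact: cvg_cst | apply: cvgM; [exact: cvg_id | exact: cvg_cst]].
have gr : g x @[x --> at_right (0 : R)] --> g 0.
  by apply: cvg_at_right_filter; exact: g_cont.
rewrite leNgt; apply/negP => g0_lt0.
suff : \forall t \near (0 : R)^'+, False by move=> /filter_ex[].
near=> t; have : g t < 0 by near: t; exact: cvgr_lt gr _ g0_lt0.
have t_gt0 : 0 < t by near: t; exact: nbhs_right_gt.
have tt0 : t < t0 by near: t; exact: nbhs_right_lt.
by rewrite ltNge g_ge0.
Unshelve. all: by end_near. Qed.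

Definition exp_sum (theta : V -> R) : R :=
  \sum_(i in P) expR (\sum_x theta x * u i x).

Definition exp_sum_grad (theta : V -> R) (x : V) : R :=
  \sum_(i in P) expR (\sum_x theta x * u i x) * u i x.

Lemma continuous_exp_sum (X : topologicalType) (f : X -> V -> R) (a : V -> R) :
  (forall x, continuous (fun t => f t x)) ->
  continuous (fun t => exp_sum (f t) + \sum_x f t x * a x).
Proof.
move=> f_cont.
have lin_cont (b : V -> R) : continuous (fun t => \sum_x f t x * b x).
  apply: (@continuous_big _ _ +%R 0); first exact: add_continuous.
  by move=> x _ t; apply: cvgM; [exact: f_cont | exact: cvg_cst].
move=> t; apply: cvgD; last exact: lin_cont.
apply: (@continuous_big _ _ +%R 0); first exact: add_continuous.
move=> i _ t'; apply: (continuous_comp (lin_cont (u i) t')).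
exact: continuous_expR.
Qed.

(** Weierstrass on the box, followed by the first order conditions: a
    coordinate that is not stuck at one of its bounds can be moved. *)
Lemma exp_sum_box_min (a lo hi : V -> R) : (forall x, lo x <= hi x) ->
  exists theta : V -> R,
  [/\ forall x, lo x <= theta x <= hi x,
      forall eta, (forall x, lo x <= eta x <= hi x) ->
        exp_sum theta + \sum_x theta x * a x <= exp_sum eta + \sum_x eta x * a x,
      forall x, lo x < theta x -> exp_sum_grad theta x + a x <= 0
    & forall x, theta x < hi x -> 0 <= exp_sum_grad theta x + a x].
Proof.
move=> lohi.
pose G (theta : V -> R) : R := exp_sum theta + \sum_x theta x * a x.
have G_cont : continuous (G : prod_topology (fun _ : V => R) -> R).
  by apply: continuous_exp_sum => x; exact: (@proj_continuous V (fun _ => R)).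
have box_compact := @tychonoff V (fun _ => R) (fun x => `[lo x, hi x])
  (fun x => @segment_compact R _ _).
have box_neq0 : [set f : V -> R | forall x, `[lo x, hi x]%classic (f x)] !=set0.
  by exists lo => x /=; rewrite in_itv /= lexx lohi.
have [theta] := @compact_EVT_min (prod_topology (fun _ : V => R)) R G _
  box_neq0 box_compact (continuous_subspaceT G_cont).
rewrite in_setE => box_theta min_theta.
have {}box_theta x : lo x <= theta x <= hi x.
  by have := box_theta x; rewrite /= in_itv.
have {}min_theta eta : (forall x, lo x <= eta x <= hi x) -> G theta <= G eta.
  move=> box_eta; apply: min_theta; rewrite in_setE => x /=.
  by rewrite in_itv; exact: box_eta.
have shift (b : V -> R) x s : \sum_y (theta y + s *+ (y == x)) * b y =
    \sum_y theta y * b y + s * b x.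
  under eq_bigr do rewrite mulrDl.
  rewrite big_split /= [X in _ + X](bigD1 x) //= eqxx mulr1n.
  by rewrite [X in _ + (_ + X)]big1 ?addr0 // => y /negbTE->; rewrite mulr0n mul0r.
(* [s] is the sign of the direction in which the coordinate [x] has room. *)
have move_coord x s t0 : 0 < t0 ->
    (forall t, 0 < t -> t < t0 -> lo x <= theta x + t * s <= hi x) ->
    0 <= s * (exp_sum_grad theta x + a x).
  move=> t0_gt0 room.
  have -> : s * (exp_sum_grad theta x + a x) =
      \sum_(i in P) expR (\sum_y theta y * u i y) * (s * u i x) + s * a x.
    by rewrite mulrDr mulr_sumr; congr (_ + _); apply: eq_bigr => i _; rewrite mulrCA.
  apply: (exp_sum_right_min t0_gt0) => t t_gt0 tt0.
  have : G theta <= G (fun y => theta y + (t * s) *+ (y == x)).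
    apply: min_theta => y; have [->|_] := eqVneq y x; first exact: room.
    by rewrite mulr0n addr0.
  rewrite /G /exp_sum shift; under [X in _ <= X + _ -> _]eq_bigr do rewrite shift -mulrA.
  by rewrite -mulrA; lra.
exists theta; split=> // x.
  move=> lox; have := move_coord x (-1) (theta x - lo x).
  rewrite subr_gt0 mulN1r oppr_ge0; apply=> // t t_gt0 tt0.
  by have /andP[_ hix] := box_theta x; lra.
move=> hix; have := move_coord x 1 (hi x - theta x).
rewrite subr_gt0 mul1r; apply=> // t t_gt0 tt0.
by have /andP[lox _] := box_theta x; lra.
Qed.

(** The linear term makes the minimiser satisfy the strict inequalities; its
    slope is so small that on the box it changes the value by at most one.
    One coordinate of [F] is pinned, because the sum is invariant under
    adding a constant on [F]. *)
Lemma exp_sum_equilibrium (F : {set V}) (K : R) :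
  0 < K -> (forall i, i \in P -> \sum_(x in F) u i x = 0) ->
  (forall theta : V -> R, (forall x, x \notin F -> theta x <= 0) ->
     (forall i, i \in P -> \sum_x theta x * u i x <= #|P|%:R + 1) ->
     (forall x, x \notin F -> - K < theta x) /\
     (forall x y, x \in F -> y \in F -> theta x < theta y + K)) ->
  exists theta : V -> R, forall x,
    if x \in F then exp_sum_grad theta x = 0 else exp_sum_grad theta x < 0.
Proof.
move=> K_gt0 balanced bounds.
(* [pinned] holds at one chosen element of [F], if [F] is nonempty. *)
pose pinned x := [pick y in F] == Some x.
pose lo x := if pinned x then 0 else - K.
pose hi x := if (x \notin F) || pinned x then 0 else K.
pose delta := (K * (#|V|%:R + 1))^-1.
have V1_gt0 : 0 < #|V|%:R + 1 :> R by rewrite ltr_wpDl ?ler0n ?ltr01.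
have delta_gt0 : 0 < delta by rewrite invr_gt0 mulr_gt0.
pose a x := if x \in F then 0 else delta.
have pinnedF x : pinned x -> x \in F.
  by rewrite /pinned; case: pickP => // y yF /eqP[<-].
have [|theta [box minG down up]] := @exp_sum_box_min a lo hi.
  by move=> x; rewrite /lo /hi; case: (pinned x); rewrite ?orbT ?orbF //;
     case: ifP => _; lra.
have theta_le0 x : x \notin F -> theta x <= 0.
  by move=> xF; have /andP[_] := box x; rewrite /hi xF.
have linear_small : - 1 <= \sum_x theta x * a x.
  have : \sum_(x : V) - (K * delta) <= \sum_x theta x * a x.
    apply: ler_sum => x _; rewrite /a; case: ifP => xF.
      by rewrite mulr0 oppr_le0 ltW // mulr_gt0.
    rewrite -mulNr ler_pM2r //; have /andP[] := box x; rewrite /lo.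
    by case: ifP => [/pinnedF|]; rewrite ?xF.
  apply: le_trans; rewrite sumr_const /delta invfM mulrA divff ?gt_eqF // mul1r.
  rewrite -[X in _ <= X]mulr_natr mulNr lerN2 mulrC ler_pdivrMr //.
  by rewrite mul1r lerDl.
have exp_le : exp_sum theta <= #|P|%:R + 1.
  have : exp_sum theta + \sum_x theta x * a x <=
      exp_sum (fun=> 0) + \sum_x 0 * a x.
    apply: minG => x; rewrite /lo /hi.
    by case: (pinned x); rewrite ?orbT ?orbF ?lexx //; case: ifP => _; lra.
  have -> : \sum_x 0 * a x = 0 by rewrite big1 // => x _; rewrite mul0r.
  have -> : exp_sum (fun=> 0) = #|P|%:R.
    rewrite /exp_sum -sumr_const; apply: eq_bigr => i _.
    by rewrite big1 ?expR0 // => x _; rewrite mul0r.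
  lra.
have [|lowA diffF] := bounds theta theta_le0.
  move=> i iP; apply: le_trans exp_le; rewrite /exp_sum (bigD1 i) //=.
  have := expR_ge1Dx (\sum_x theta x * u i x).
  suff : 0 <= \sum_(j in P | j != i) expR (\sum_x theta x * u j x) by lra.
  by apply: sumr_ge0 => j _; exact: expR_ge0.
have free x : x \in F -> ~~ pinned x -> exp_sum_grad theta x = 0.
  move=> xF xp; have [y py] : exists y, pinned y.
    by rewrite /pinned; case: pickP => [y _|/(_ x)]; [exists y; rewrite eqxx|rewrite xF].
  have thy : theta y = 0.
    by have := box y; rewrite /lo /hi py orbT -eq_le => /eqP <-.
  have := diffF x y xF (pinnedF _ py); have := diffF y x (pinnedF _ py) xF.
  rewrite thy add0r => lox hix.
  have := down x; have := up x.
  rewrite /lo /hi /a xF (negbTE xp) /= addr0 => /(_ hix) ge0 H.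
  by apply/eqP; rewrite eq_le ge0 andbT; apply: H; lra.
exists theta => x; case: ifPn => xF; last first.
  have := down x; rewrite /lo /a (negbTE xF).
  rewrite ifN; last by apply: contra xF => /pinnedF.
  by move=> /(_ (lowA _ xF)); lra.
have [px|px] := boolP (pinned x); last exact: free.
(* The derivatives over [F] sum to zero, which determines the pinned one. *)
have : \sum_(y in F) exp_sum_grad theta y = 0.
  rewrite exchange_big big1 // => i iP /=.
  by rewrite -mulr_sumr balanced ?mulr0.
rewrite (bigD1 x) //= big1 ?addr0 // => y /andP[yF yx]; apply: free => //.
by apply: contraNN yx => /eqP py; move/eqP: px; rewrite py => -[->].
Qed.

End BoxMinimum.

(** * Curvature as a gradient *)

Section Curvature.
Local Open Scope ring_scope.
Variables (R : realType) (T : finType) (e : rel T).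
Hypotheses (e_sym : symmetric e) (e_irr : irreflexive e).
Implicit Types (S : {set {set T}}) (x y : T) (theta : T -> R).

Definition degree_in S x := #|[set f in S | x \in f]|.

Lemma degree_in_neighbours S x : S \subset edges e ->
  degree_in S x = #|[set y | e y x & [set y; x] \in S]|.
Proof.
move=> Se; rewrite -(card_in_imset (f := fun y => [set y; x])); last first.
  move=> y z; rewrite !inE => /andP[yx _] /andP[zx _] /setP/(_ y).
  rewrite !inE eqxx => /esym/orP[]/eqP // yE.
  by rewrite yE e_irr in yx.
congr #|pred_of_set _|; apply/setP => f; rewrite !inE.
apply/andP/imsetP => [[fS xf]|[y]]; last first.
  by rewrite !inE => /andP[_ yxS] ->; rewrite yxS !inE eqxx orbT.
have /edgesP[[a b] /= ab fE] := subsetP Se _ fS.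
move: xf; rewrite fE !inE => /orP[]/eqP xE.
  by exists b; rewrite ?inE xE 1?e_sym 1?setUC ?ab //= -fE.
by exists a; rewrite ?inE xE ?ab -?fE.
Qed.

Lemma sum_degree_in S theta :
  \sum_(f in S) \sum_(x in f) theta x = \sum_x theta x * (degree_in S x)%:R.
Proof.
rewrite (exchange_big_dep predT) //=; apply: eq_bigr => x _.
by rewrite sumr_const mulr_natr; congr (_ *+ _); apply: eq_card => f; rewrite !inE.
Qed.

Lemma sum_degree_in_bipartite S (F : {set T}) :
  (forall x y, e x y -> (x \in F) != (y \in F)) -> S \subset edges e ->
  \sum_(x in F) (degree_in S x)%:R = #|S|%:R :> R.
Proof.
move=> bip Se; have := sum_degree_in S (fun x => (x \in F)%:R).
have -> : \sum_x (x \in F)%:R * (degree_in S x)%:R = \sum_(x in F) (degree_in S x)%:R :> R.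
  by rewrite [RHS]big_mkcond; apply: eq_bigr => x _; case: ifP; rewrite ?mul1r ?mul0r.
move=> <-; rewrite -sumr_const; apply: eq_bigr => f /(subsetP Se) /edgesP[[a b] /= ab ->].
have aNb : a != b by apply: contraTneq ab => ->; rewrite e_irr.
rewrite big_setU1 ?inE //= big_set1; have := bip a b ab.
by case: (a \in F) (b \in F) => -[] //=; rewrite ?addr0 ?add0r.
Qed.

(** Counting the pairs formed by an edge at [x] and a tree through it: the
    relative resistances around [x] add up to the mean degree of [x]. *)
Lemma resistance_curvatureE c x :
  \sum_(S in spanning_trees e) tree_weight c S != 0 :> R ->
  resistance_curvature e c x =
    (\sum_(S in spanning_trees e) tree_weight c S * (2 - (degree_in S x)%:R)) /
    (2 * \sum_(S in spanning_trees e) tree_weight c S).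
Proof.
move=> W0; rewrite /resistance_curvature.
have -> : \sum_(u | e u x) relative_resistance e c u x =
    (\sum_(S in spanning_trees e) tree_weight c S * (degree_in S x)%:R) /
    (\sum_(S in spanning_trees e) tree_weight c S).
  rewrite /relative_resistance -mulr_suml; congr (_ / _).
  rewrite (exchange_big_dep (mem (spanning_trees e))) /=; last by move=> u S _ /andP[].
  apply: eq_bigr => S SST; have /asboolP[Se _ _] : `[< spanning_tree e S >] by rewrite inE in SST.
  rewrite degree_in_neighbours // mulr_natr -sumr_const.
  by apply: eq_bigl => u; rewrite SST inE.
set W := \sum_(S in _) tree_weight c S in W0 *.
under [in RHS]eq_bigr do rewrite mulrBr.
by rewrite sumrB -mulr_suml -/W; field; rewrite W0.
Qed.

Definition vertex_conductance theta (f : {set T}) : R := expR (\sum_(x in f) theta x).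

(** The curvature vanishes where the mean degree is 2. *)
Definition degree_excess S x : R := (degree_in S x)%:R - 2.

Lemma sum_degree_excess S theta :
  \sum_x theta x * degree_excess S x =
  \sum_(f in S) \sum_(x in f) theta x - 2 * \sum_x theta x.
Proof.
rewrite sum_degree_in mulr_sumr -sumrB; apply: eq_bigr => x _.
by rewrite mulrBr (mulrC 2).
Qed.

Lemma tree_weight_vertex theta S :
  tree_weight (vertex_conductance theta) S =
  expR (\sum_x theta x * degree_excess S x) * expR (2 * \sum_x theta x).
Proof. by rewrite -expRD sum_degree_excess subrK /tree_weight expR_sum. Qed.

Lemma resistance_curvature_vertex theta x S0 : S0 \in spanning_trees e ->
  exists2 k : R, 0 < k &
  resistance_curvature e (vertex_conductance theta) x =
    - (k * exp_sum_grad (spanning_trees e) degree_excess theta x).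
Proof.
move=> S0T; set W := \sum_(S in spanning_trees e) tree_weight (vertex_conductance theta) S.
have W_gt0 : 0 < W.
  rewrite /W (bigD1 S0) //= ltr_wpDr //.
    by apply: sumr_ge0 => S _; rewrite tree_weight_vertex mulr_ge0 ?expR_ge0.
  by rewrite tree_weight_vertex mulr_gt0 ?expR_gt0.
exists (expR (2 * \sum_x theta x) / (2 * W)).
  by rewrite divr_gt0 ?expR_gt0 // mulr_gt0.
rewrite resistance_curvatureE -/W ?gt_eqF // mulrAC -mulNr; congr (_ / _).
rewrite /exp_sum_grad mulr_sumr -sumrN; apply: eq_bigr => S _.
by rewrite tree_weight_vertex /degree_excess; ring.
Qed.

End Curvature.

(** * Exchange inequalities along a folded path *)

Section UniformDomination.
Variables (R : realFieldType) (Phi : (nat -> R) -> Prop).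
Local Open Scope ring_scope.

Definition bounded_below (p : nat) :=
  exists c : R, forall phi, Phi phi -> - c <= phi p.

(** A preorder, because the constant is uniform over the class [Phi]. *)
Definition dominated (p q : nat) :=
  exists c : R, forall phi, Phi phi -> phi p <= phi q + c.

Lemma dominated_trans q p r : dominated p q -> dominated q r -> dominated p r.
Proof.
move=> [c pq] [c' qr]; exists (c + c') => phi ph.
by have := pq _ ph; have := qr _ ph; lra.
Qed.

Lemma bounded_dominated p q :
  bounded_below p -> dominated p q -> bounded_below q.
Proof.
move=> [c pc] [c' pq]; exists (c + c') => phi ph.
by have := pq _ ph; have := pc _ ph; lra.
Qed.

End UniformDomination.

Section SnakePotentials.
Variables (R : realFieldType) (M : R) (m n : nat).
Hypotheses (M_ge0 : (0 <= M)%R) (m_gt1 : 1 < m) (n_gt1 : 1 < n).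

(** Positions [0, m * n) are read in [n] rows of length [m]; [i] in row [k]
    and [j] in row [k + 1] with [i + j + 1 = 2 * m * (k + 1)] lie next to each
    other in the boustrophedon order. *)
Definition snake_chord (k i j : nat) :=
  [/\ k.+1 < n, m * k <= i, i < m * k.+1 & i + j + 1 = 2 * (m * k.+1)].

(** The inequalities that spanning trees impose on [phi p = theta (v p)], seen
    as statements about positions only. *)
Definition snake_potential (phi : nat -> R) : Prop :=
  [/\ (- M <= phi 0)%R, (- M <= phi (m * n).-1)%R
    & forall k i j l, snake_chord k i j -> i <= l -> l < j ->
        (phi i + phi j <= phi l + phi l.+1 + M)%R].

Lemma snake_potential_rev phi : snake_potential phi ->
  snake_potential (fun p => phi ((m * n).-1 - p)).
Proof.
move=> [phi0 phiN chord]; split.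
- by rewrite subn0.
- by rewrite subnn.
move=> k i j l [kn ki ik ijk] il lj.
have mn : m * n = m * k.+1 + m * (n - k.+1) by rewrite -mulnDr subnKC // ltnW.
have mnk : m * (n - k.+1) = m * (n - k.+2) + m.
  by rewrite -(subnSK kn) mulnS addnC.
have mk : m * k.+1 = m * k + m by rewrite mulnS addnC.
have ch : snake_chord (n - k.+2) ((m * n).-1 - j) ((m * n).-1 - i).
  by split; rewrite ?subnSK //; lia.
have lE : (m * n).-1 - l = ((m * n).-1 - l.+1).+1 by lia.
have := chord _ _ _ ((m * n).-1 - l.+1) ch.
rewrite lE; set i' := _ - i; set j' := _ - j; set l' := _ - l.+1 => H.
have {H}: (phi j' + phi i' <= phi l' + phi l'.+1 + M)%R.
  by apply: H; rewrite /i' /j' /l'; lia.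
lra.
Qed.

Let dom := dominated snake_potential.
Let bounded := bounded_below snake_potential.

Let rowS k : m * k.+1 = m * k + m.
Proof. by rewrite mulnS addnC. Qed.

(** The deleted edge is the last one of the cycle: the value at [p.+1] cancels. *)
Lemma reflect_up k i p : k.+1 < n -> m * k <= i -> i < m * k.+1 ->
  i + p + 2 = 2 * (m * k.+1) -> dom i p.
Proof.
move=> kn ki ik ip; exists M => phi [_ _ /(_ k i p.+1 p)].
have ch : snake_chord k i p.+1 by split=> //; lia.
move=> /(_ ch) H; have {H}: (phi i + phi p.+1 <= phi p + phi p.+1 + M)%R.
  by apply: H; lia.
lra.
Qed.

(** The deleted edge is the first one of the cycle. *)
Lemma reflect_down k j p : k.+1 < n -> m * k.+1 <= j -> j < m * k.+2 ->
  j + p = 2 * (m * k.+1) -> dom j p.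
Proof.
have := rowS k; have := rowS k.+1 => r1 r0.
move=> kn kj jk jp; exists M => phi [_ _ /(_ k p.-1 j p.-1)].
have pE : p.-1.+1 = p by lia.
have ch : snake_chord k p.-1 j by split=> //; lia.
move=> /(_ ch); rewrite pE => H.
have {H}: (phi p.-1 + phi j <= phi p.-1 + phi p + M)%R by apply: H; lia.
lra.
Qed.

(** Reflecting into the next row and back moves two positions ahead. *)
Lemma step_up k i : k.+1 < n -> m * k <= i -> i + 2 <= m * k.+1 -> dom i (i + 2).
Proof.
have := rowS k; have := rowS k.+1 => r1 r0.
move=> kn ki ik; apply: (dominated_trans (q := 2 * (m * k.+1) - 2 - i)).
  by apply: (@reflect_up k); lia.
by apply: (@reflect_down k) => //; lia.
Qed.

(** Rows are conquered one after the other: reflecting row [k] into row [k + 1]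
    misses only the last position of the latter, which is either the end of
    the path or two positions after one already reached, in the next pair of
    rows. *)
Lemma even_bounded p : p < m * n -> ~~ odd p -> bounded p.
Proof.
have b0 : bounded 0 by exists M => phi [].
have bN : bounded (m * n).-1 by exists M => phi [].
suff row k : k < n ->
    forall q, ~~ odd q -> m * k <= q -> q < m * k.+1 -> bounded q.
  move=> pN op; have pm : p %/ m < n by rewrite ltn_divLR; [rewrite mulnC|exact: ltnW].
  apply: (row _ pm) => //; first by rewrite mulnC leq_divM.
  by rewrite mulnC ltn_ceil // ltnW.
elim: k => [|k IHk] kn q oq kq qk.
  have -> : q = 0 + q./2.*2 by lia.
  have : q./2.*2 < m by lia.
  elim: (q./2) => [|t IHt] tm //.
  apply: (bounded_dominated (p := 0 + t.*2)); first by apply: IHt; lia.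
  have -> : 0 + t.+1.*2 = 0 + t.*2 + 2 by lia.
  by apply: (@step_up 0); lia.
have r1 := rowS k.+1; have r0 := rowS k.
have reflected q' : ~~ odd q' -> m * k.+1 <= q' -> q' + 2 <= m * k.+2 -> bounded q'.
  move=> oq' kq' qk'.
  apply: (bounded_dominated (p := 2 * (m * k.+1) - 2 - q')).
    by apply: IHk; lia.
  by apply: (@reflect_up k) => //; lia.
have [qlast|qlast] := leqP (q + 2) (m * k.+2); first exact: reflected.
have qE : q = (m * k.+2).-1 by lia.
have [kn2|nk2] := ltnP k.+2 n; last first.
  by rewrite qE (_ : k.+2 = n) //; lia.
have om : odd m.
  apply: contraNT oq => em; rewrite qE; have : ~~ odd (m * k.+2) by rewrite oddM (negbTE em).
  lia.
apply: (bounded_dominated (p := q - 2)); first by apply: reflected; lia.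
have {2}-> : q = q - 2 + 2 by lia.
by apply: (@step_up k.+1) => //; lia.
Qed.

(** When [m * n] is even the two ends of the path have opposite parities, so
    reading the path backwards turns even positions into odd ones. *)
Lemma all_bounded p : ~~ odd (m * n) -> p < m * n -> bounded p.
Proof.
move=> ev pN; have [op|] := boolP (odd p); last exact: even_bounded.
have [c bc] : bounded ((m * n).-1 - p) by apply: even_bounded; lia.
exists c => phi /snake_potential_rev /bc.
by rewrite (_ : _ - (_ - p) = p) //; lia.
Qed.

Section Odd.
Hypothesis odd_mn : odd (m * n).

Definition signed_snake_potential (phi : nat -> R) : Prop :=
  snake_potential phi /\
  forall p, p < m * n -> ~~ odd p -> (phi p <= 0)%R.

Let sdom := dominated signed_snake_potential.

Let om : odd m. Proof. by move: odd_mn; rewrite oddM => /andP[]. Qed.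
Let on : odd n. Proof. by move: odd_mn; rewrite oddM => /andP[]. Qed.

(** The two ends of a chord have opposite parities and the even values are
    bounded on both sides, so that the exchange inequality compares the odd
    end with any odd position enclosed by the chord. *)
Lemma chord_dominated k i j o b : snake_chord k i j ->
  (o == i) || (o == j) -> odd o -> odd b -> i <= b <= j -> sdom o b.
Proof.
move=> ch oij oo ob /andP[ib bj]; have [kn ki ik ijk] := ch.
have r0 := rowS k; have r1 := rowS k.+1.
have jN : j < m * n.
  have : m * k.+2 <= m * n by rewrite leq_mul2l kn orbT.
  by lia.
set e := i + j - o; have eN : e < m * n by rewrite /e; lia.
have [c ec] : bounded e by apply: even_bounded => //; rewrite /e; lia.
exists (c + M)%R => phi [pot sgn].
have -> : (phi o = phi i + phi j - phi e)%R.
  case/orP: oij => /eqP oE; rewrite /e oE ?addnK ?addKn; lra.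
have {}ec := ec _ pot; have [_ _ /(_ k i j _ ch) exch] := pot.
have [bj'|bj'] := ltnP b j.
  have sb : (phi b.+1 <= 0)%R by apply: sgn; lia.
  by have := exch b ib bj'; lra.
have bE : b.-1.+1 = b by lia.
have sb : (phi b.-1 <= 0)%R by apply: sgn; lia.
have H := exch b.-1; rewrite bE in H.
have {H} : (phi i + phi j <= phi b.-1 + phi b + M)%R by apply: H; lia.
lra.
Qed.

(** Two hubs: [o1] and [o2] are the odd ends of the longest chords of the two
    pairs of rows, so together they dominate all the odd positions, and each
    is at the fold of the other pair, where it is enclosed by every chord of
    that pair. *)
Lemma three_rows_dominated h b b' : ~~ odd h -> h.+2 < n -> odd b -> odd b' ->
  m * h <= b < m * h.+3 -> m * h <= b' < m * h.+3 -> sdom b b'.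
Proof.
move=> eh hn ob ob' hb hb'.
have r0 := rowS h; have r1 := rowS h.+1; have r2 := rowS h.+2.
have emh : ~~ odd (m * h) by rewrite oddM om.
have ch1 i j : m * h <= i -> i < m * h.+1 -> i + j + 1 = 2 * (m * h.+1) ->
  snake_chord h i j by split=> //; lia.
have ch2 i j : m * h.+1 <= i -> i < m * h.+2 -> i + j + 1 = 2 * (m * h.+2) ->
  snake_chord h.+1 i j by split=> //; lia.
pose o1 := (m * h.+2).-1; pose o2 := m * h.+1.
have from1 c : odd c -> m * h <= c < m * h.+2 -> sdom o1 c.
  move=> oc hc; apply: (@chord_dominated h (m * h) o1); rewrite ?eqxx ?orbT //.
  - by apply: ch1; rewrite /o1; lia.
  - by rewrite /o1; lia.
  - by rewrite /o1; lia.
have from2 c : odd c -> m * h.+1 <= c < m * h.+3 -> sdom o2 c.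
  move=> oc hc; apply: (@chord_dominated h.+1 o2 (m * h.+3).-1); rewrite ?eqxx //.
  - by apply: ch2; rewrite /o2; lia.
  - by rewrite /o2; lia.
  - by rewrite /o2; lia.
have hub c : odd c -> m * h <= c < m * h.+3 -> sdom c o2.
  move=> oc hc.
  have [c1|c1] := ltnP c (m * h.+1).
    apply: (@chord_dominated h c (2 * (m * h.+1) - 1 - c)); rewrite ?eqxx //.
    - by apply: ch1; lia.
    - by rewrite /o2; lia.
    - by rewrite /o2; lia.
  have [c2|c2] := ltnP c (m * h.+2).
    apply: (@chord_dominated h (2 * (m * h.+1) - 1 - c) c); rewrite ?eqxx ?orbT //.
    - by apply: ch1; lia.
    - by rewrite /o2; lia.
    - by rewrite /o2; lia.
  apply: (dominated_trans (q := o1)); last by apply: from1; rewrite /o2; lia.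
  apply: (@chord_dominated h.+1 (2 * (m * h.+2) - 1 - c) c); rewrite ?eqxx ?orbT //.
  - by apply: ch2; lia.
  - by rewrite /o1; lia.
  - by rewrite /o1; lia.
apply: (dominated_trans (hub b ob hb)).
have [b2|b2] := ltnP b' (m * h.+2); last by apply: from2 => //; lia.
apply: (dominated_trans (q := o1)); last by apply: from1 => //; lia.
by apply: from2; rewrite /o1; lia.
Qed.

(** Overlapping triples of rows share a row, which contains an odd position. *)
Lemma odd_dominated b b' : odd b -> odd b' -> b < m * n -> b' < m * n ->
  sdom b b'.
Proof.
suff to1 t c : t.*2.+2 < n -> odd c -> c < m * t.*2.+3 -> sdom c 1 /\ sdom 1 c.
  have nE : n = (n./2.-1).*2.+3 by lia.
  move=> ob ob' bN bN'; apply: (dominated_trans (q := 1)).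
    by have [] := @to1 (n./2.-1) b; rewrite -?nE //; lia.
  by have [] := @to1 (n./2.-1) b'; rewrite -?nE //; lia.
elim: t c => [|t IHt] c tn oc cm.
  have m3 : 2 < m by lia.
  have r2 := rowS 2; have r1 := rowS 1; have r0 := rowS 0.
  by split; apply: (@three_rows_dominated 0) => //; lia.
have [c3|c3] := ltnP c (m * t.*2.+3); first by apply: IHt => //; lia.
have r4 := rowS t.+1.*2.+2; have r3 := rowS t.+1.*2.+1; have r2 := rowS t.+1.*2.
pose r := (m * t.+1.*2).+1.
have er : ~~ odd (m * t.+1.*2) by rewrite oddM odd_double andbF.
have [r1 r1'] : sdom r 1 /\ sdom 1 r by apply: IHt; rewrite /r; lia.
split.
  apply: dominated_trans r1.
  by apply: (@three_rows_dominated t.+1.*2) => //; rewrite /r ?odd_double //; lia.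
apply: (dominated_trans r1').
by apply: (@three_rows_dominated t.+1.*2) => //; rewrite /r ?odd_double //; lia.
Qed.

End Odd.

End SnakePotentials.

(** * Graphs with a folded Hamiltonian path *)

(** [v] lists the vertices along a Hamiltonian path of [m * n] positions and
    [pos] is its inverse; the parity of the position is a proper 2-colouring. *)
Section SnakeGraph.
Local Open Scope ring_scope.
Variables (R : realType) (T : finType) (e : rel T) (m n : nat).
Variables (v : nat -> T) (pos : T -> nat).
Hypotheses (e_sym : symmetric e) (e_irr : irreflexive e).
Hypotheses (m_gt1 : (1 < m)%N) (n_gt1 : (1 < n)%N).
Hypothesis pos_lt : forall x, (pos x < m * n)%N.
Hypothesis vK : forall p, (p < m * n)%N -> pos (v p) = p.
Hypothesis posK : forall x, v (pos x) = x.
Hypothesis snake_path : forall p, (p.+1 < m * n)%N -> e (v p) (v p.+1).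
Hypothesis snake_chordE : forall k i j, snake_chord m n k i j -> e (v i) (v j).
Hypothesis alternating : forall x y, e x y -> odd (pos x) != odd (pos y).

Let mn_gt1 : (1 < m * n)%N.
Proof. by apply: (leq_trans m_gt1); rewrite leq_pmulr // ltnW. Qed.

Let v_inj p q : (p < m * n)%N -> (q < m * n)%N -> v p = v q -> p = q.
Proof. by move=> pN qN vpq; rewrite -(vK pN) vpq vK. Qed.

Lemma card_snake : #|T| = (m * n)%N.
Proof.
rewrite -[RHS]card_ord; apply: (bij_eq_card (f := fun x => Ordinal (pos_lt x))).
exists (fun p => v (val p)) => [x|p] /=; first exact: posK.
by apply: val_inj; rewrite /= vK.
Qed.

Lemma sum_snake (theta : T -> R) : \sum_x theta x = \sum_(p < m * n) theta (v p).
Proof.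
rewrite (reindex (fun p : 'I_(m * n) => v p)) //.
exists (fun x => Ordinal (pos_lt x)) => [p|x] _ /=; last exact: posK.
by apply: val_inj; rewrite /= vK.
Qed.

Definition snake_edge p : {set T} := [set v p; v p.+1].

Definition snake_tree : {set {set T}} := [set snake_edge p | p : 'I_(m * n).-1].

Definition exchanged_tree i j l : {set {set T}} :=
  [set v i; v j] |: (snake_tree :\ snake_edge l).

Lemma snake_edge_eq i j p : (i < j)%N -> (j < m * n)%N -> (p.+1 < m * n)%N ->
  [set v i; v j] = snake_edge p -> i = p /\ j = p.+1.
Proof.
move=> ij jN pN E.
have memE q : v q \in [set v i; v j] -> (q < m * n)%N -> q = i \/ q = j.
  by rewrite !inE => /orP[]/eqP E' qN; [left|right]; apply: v_inj E'; lia.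
have memP q : v q \in snake_edge p -> (q < m * n)%N -> q = p \/ q = p.+1.
  by rewrite !inE => /orP[]/eqP E' qN; [left|right]; apply: v_inj E'; lia.
have /memP-/(_ (ltn_trans ij jN)) : v i \in snake_edge p by rewrite -E set21.
have /memP-/(_ jN) : v j \in snake_edge p by rewrite -E set22.
have /memE-/(_ (ltnW pN)) : v p \in [set v i; v j] by rewrite E set21.
have /memE-/(_ pN) : v p.+1 \in [set v i; v j] by rewrite E set22.
lia.
Qed.

Lemma snake_edge_inj p q : (p.+1 < m * n)%N -> (q.+1 < m * n)%N ->
  snake_edge p = snake_edge q -> p = q.
Proof. by move=> pN qN E; have [] := snake_edge_eq (ltnSn p) pN qN E. Qed.

Lemma mem_snake_tree p : (p.+1 < m * n)%N -> snake_edge p \in snake_tree.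
Proof.
move=> pN; have pN' : (p < (m * n).-1)%N by lia.
by apply/imsetP; exists (Ordinal pN').
Qed.

Lemma snake_treeP f : reflect (exists2 p, (p.+1 < m * n)%N & f = snake_edge p)
  (f \in snake_tree).
Proof.
apply: (iffP imsetP) => [[p _ ->]|[p pN ->]].
  by exists p => //; have := ltn_ord p; lia.
have pN' : (p < (m * n).-1)%N by lia.
by exists (Ordinal pN').
Qed.

Lemma connect_segment (r : rel T) p q : (p <= q)%N ->
  (forall t, (p <= t)%N -> (t < q)%N -> r (v t) (v t.+1)) ->
  connect r (v p) (v q).
Proof.
elim: q => [|q IHq]; first by rewrite leqn0 => /eqP-> _; exact: connect0.
rewrite leq_eqVlt => /orP[/eqP-> _|pq rS]; first exact: connect0.
apply: connect_trans (IHq pq _) _ => [t pt tq|]; last exact/connect1/rS.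
by apply: rS => //; exact: ltnW.
Qed.

(** The new edge closes a cycle with the segment of the path between its ends,
    and the removed edge lies on that cycle. *)
Lemma exchanged_tree_spanning i j l : e (v i) (v j) ->
  (i <= l)%N -> (l < j)%N -> (j < m * n)%N ->
  exchanged_tree i j l \in spanning_trees e.
Proof.
move=> eij il lj jN; rewrite inE; apply/asboolP.
have lN : (l.+1 < m * n)%N by lia.
apply: (spanning_tree_of_card (v 0)).
- rewrite subUset sub1set mem_edges //=; apply: subset_trans (subsetDl _ _) _.
  apply/subsetP => f /snake_treeP[p pN ->].
  by apply: mem_edges; exact: snake_path.
- have step q : q != l -> (q.+1 < m * n)%N ->
      adj_in (exchanged_tree i j l) (v q) (v q.+1).
    move=> ql qN; rewrite /adj_in /= !inE -/(snake_edge q) mem_snake_tree // andbT.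
    by apply/orP; right; apply: contraNneq ql => /snake_edge_inj ->.
  have reach x : connect (adj_in (exchanged_tree i j l)) (v i) x.
    rewrite -(posK x); have := pos_lt x; move: (pos x) => p pN.
    have [pl|lp] := leqP p l.
      have [ip|pi] := leqP i p; last rewrite connect_adj_sym.
        by apply: connect_segment => // q iq qp; apply: step; lia.
      by apply: connect_segment => [|q iq qp]; [exact: ltnW | apply: step; lia].
    apply: (connect_trans (y := v j)).
      by apply: connect1; rewrite /adj_in /= setU11.
    have [jp|pj] := leqP j p; last rewrite connect_adj_sym.
      by apply: connect_segment => // q iq qp; apply: step; lia.
    by apply: connect_segment => [|q iq qp]; [exact: ltnW | apply: step; lia].
  move=> x y; apply: connect_trans (reach y).
  by rewrite connect_adj_sym.
- rewrite card_snake cardsU1; apply: leq_ltn_trans (leq_add (leq_b1 _) (leqnn _)) _.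
  have <- : true = 1%N :> nat by []; rewrite -(mem_snake_tree lN) -cardsD1.
  apply: leq_ltn_trans (leq_imset_card _ _) _.
  by rewrite card_ord ltn_predL ltnW.
Qed.

(** In the path every degree is 2, except that both ends have degree 1; hence
    the terms at [v 0] and at the last position. *)
Lemma sum_exchanged_tree (theta : T -> R) i j l :
  (i <= l)%N -> (l < j)%N -> (j < m * n)%N ->
  \sum_x theta x * degree_excess R (exchanged_tree i j l) x =
  theta (v i) + theta (v j) - theta (v l) - theta (v l.+1)
    - theta (v 0) - theta (v (m * n).-1).
Proof.
move=> il lj jN; have lN : (l.+1 < m * n)%N by lia.
rewrite sum_degree_excess.
have pair i' j' : (i' < j')%N -> (j' < m * n)%N ->
    \sum_(x in [set v i'; v j']) theta x = theta (v i') + theta (v j').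
  move=> ij' jN'; rewrite big_setU1 ?big_set1 // inE; apply/eqP => E.
  by have := v_inj (ltn_trans ij' jN') jN' E; lia.
rewrite big_setU1 ?pair //=; last 2 first.
- exact: leq_ltn_trans il lj.
- rewrite !inE; apply/nandP; have [/snake_treeP[p pN E]|_] := boolP (_ \in snake_tree).
    left; rewrite negbK E; have [|ip jp] := snake_edge_eq _ jN pN E; first by lia.
    by apply/eqP; congr snake_edge; lia.
  by right.
have tree_sum : \sum_(f in snake_tree) \sum_(x in f) theta x =
    2 * \sum_x theta x - theta (v 0) - theta (v (m * n).-1).
  rewrite big_imset /=; last first.
    by move=> p q _ _ /snake_edge_inj E; apply/val_inj/E; have := ltn_ord p; have := ltn_ord q; lia.
  rewrite (eq_bigr (fun p : 'I__ => theta (v p) + theta (v p.+1))); last first.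
    by move=> p _; apply: pair => //; have := ltn_ord p; lia.
  rewrite big_split /= sum_snake.
  have -> : (m * n)%N = (m * n).-1.+1 by lia.
  rewrite /=; set N := (m * n).-1.
  have E1 := big_ord_recl N (op := +%R) (idx := 0) (fun p : 'I_N.+1 => theta (v p)).
  have E2 := big_ord_recr N (op := +%R) (idx := 0) (fun p : 'I_N.+1 => theta (v p)).
  move: E1 E2 => /= E1 E2; rewrite mulr2n mulrDl mul1r {1}E1 E2 /=; lra.
have := big_setD1 (snake_edge l) (mem_snake_tree lN) (aop := +%R) (idx := 0)
  (F := fun f => \sum_(x in f) theta x).
rewrite tree_sum /= [X in _ = X + _]pair //; lra.
Qed.

(** The two terms of the path ends may be dropped from the exponent of an
    exchanged tree since [theta] is nonpositive there. *)
Lemma excess_snake_potential (theta : T -> R) (M : R) :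
  theta (v 0) <= 0 -> theta (v (m * n).-1) <= 0 ->
  (forall S, S \in spanning_trees e -> \sum_x theta x * degree_excess R S x <= M) ->
  snake_potential M m n (fun p => theta (v p)).
Proof.
move=> th0 thN excess.
have exchange i j l : e (v i) (v j) -> (i <= l)%N -> (l < j)%N -> (j < m * n)%N ->
    theta (v i) + theta (v j) - theta (v l) - theta (v l.+1)
      - theta (v 0) - theta (v (m * n).-1) <= M.
  by move=> eij il lj jN; rewrite -sum_exchanged_tree // excess ?exchanged_tree_spanning.
(* Exchanging an edge of the path for itself gives the path itself. *)
have := exchange 0 1 0 (snake_path mn_gt1) (leqnn _) (ltnSn _) mn_gt1.
split; try lra.
move=> k i j l ch il lj; have [kn ki ik ijk] := ch.
have jN : (j < m * n)%N.
  have : (m * k.+2 <= m * n)%N by rewrite leq_mul2l kn orbT.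
  by rewrite !mulnS in ik ijk *; lia.
by have := exchange i j l (snake_chordE ch) il lj jN; lra.
Qed.

Lemma finite_bound (I : finType) (Q : I -> R -> Prop) :
  (forall i, exists c, Q i c) ->
  exists K, 0 < K /\ forall i, exists2 c, Q i c & c < K.
Proof.
move=> /choice[c Qc]; exists (1 + \sum_i `|c i|); split.
  by rewrite ltr_pwDl // sumr_ge0.
move=> i; exists (c i) => //; rewrite (bigD1 i) //=.
have : 0 <= \sum_(j | j != i) `|c j| by apply: sumr_ge0.
by have := ler_norm (c i); lra.
Qed.

Definition odd_positions : {set T} := [set x | odd (pos x)].

Lemma card_odd_positions : #|odd_positions| = (m * n)./2.
Proof.
have -> : #|odd_positions| = (\sum_(p < m * n) odd p)%N.
  rewrite -sum1_card big_mkcond /= (reindex (fun p : 'I_(m * n) => v p)) /=.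
    by apply: eq_bigr => p _; rewrite inE vK //; case: odd.
  exists (fun x => Ordinal (pos_lt x)) => [p|x] _ /=; last exact: posK.
  by apply: val_inj; rewrite /= vK.
elim: (m * n)%N => [|N IHN]; first by rewrite big_ord0.
by rewrite big_ord_recr /= IHN uphalf_half addnC.
Qed.

Lemma sum_excess_odd_positions S : odd (m * n) -> S \in spanning_trees e ->
  \sum_(x in odd_positions) degree_excess R S x = 0.
Proof.
move=> omn; rewrite inE => /asboolP Stree; have [Se _ _] := Stree.
rewrite sumrB (sum_degree_in_bipartite _ e_irr _ Se); last first.
  by move=> x y /alternating; rewrite !inE.
have := spanning_tree_card (v 0) e_irr Stree; rewrite card_snake => cS.
rewrite sumr_const card_odd_positions -[2 *+ _]mulr_natr -natrM.
by apply/eqP; rewrite subr_eq0 eqr_nat; apply/eqP; lia.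
Qed.

(** The admissible [theta], those with all exponents at most [M], are snake
    potentials, and the comparisons between positions then give the bounds
    that the existence of an equilibrium requires. *)
Lemma snake_curvature : exists2 c : {set T} -> R, conductance e c &
  forall x, if odd (m * n) && odd (pos x) then resistance_curvature e c x = 0
            else 0 < resistance_curvature e c x.
Proof.
pose P := spanning_trees e; pose u := @degree_excess R T.
pose F := if odd (m * n) then odd_positions else set0.
have inF x : (x \in F) = odd (m * n) && odd (pos x).
  by rewrite /F; case: odd; rewrite inE.
pose M : R := #|P|%:R + 1; have M_ge0 : 0 <= M by rewrite addr_ge0.
pose admissible theta := (forall x, x \notin F -> theta x <= 0) /\
  (forall S, S \in P -> \sum_x theta x * u S x <= M).
have potential theta : admissible theta -> snake_potential M m n (fun p => theta (v p)).
  move=> [sgn exc]; apply: excess_snake_potential => //; apply: sgn.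
    by rewrite inF vK ?andbF // ltnW.
  by rewrite inF vK; lia.
have [|K [K_gt0 bounds]] := @finite_bound (T * T)%type (fun xy c =>
    forall theta, admissible theta ->
      (xy.1 \notin F -> - c <= theta xy.1) /\
      (xy.1 \in F -> xy.2 \in F -> theta xy.1 <= theta xy.2 + c)).
  move=> [x y] /=; have [|xF] := boolP (x \in F); last first.
    have [c bc] : bounded_below (snake_potential M m n) (pos x).
      have [omn|emn] := boolP (odd (m * n)); last exact: all_bounded.
      by apply: even_bounded => //; move: xF; rewrite inF omn.
    by exists c => theta /potential /bc; rewrite posK.
  have [|yF] := boolP (y \in F); last by exists 0.
  rewrite !inF => /andP[omn oy] /andP[_ ox].
  have [c bc] := odd_dominated M_ge0 m_gt1 n_gt1 omn ox oy (pos_lt x) (pos_lt y).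
  exists c => theta adm; split=> // _ _.
  have := bc (fun p => theta (v p)); rewrite !posK; apply; split; first exact: potential.
  by move=> p pN ep; apply: adm.1; rewrite inF vK // (negbTE ep) andbF.
have [S PS] : exists S, S \in P.
  by exists (exchanged_tree 0 1 0); apply: exchanged_tree_spanning => //; apply: snake_path.
have [||theta eq] := @exp_sum_equilibrium R _ _ P u F K K_gt0.
- move=> S' PS'; have [omn|_] := boolP (odd (m * n)).
    by rewrite /F omn sum_excess_odd_positions.
  by rewrite /F; case: ifP => [omn|_]; [rewrite sum_excess_odd_positions|rewrite big_set0].
- move=> theta sgn exc; have adm : admissible theta by [].
  split=> [x xF|x y xF yF].
    have [c /(_ _ adm) [/= /(_ xF) cx _] cK] := bounds (x, x); lra.
  have [c /(_ _ adm) [_ /= /(_ xF yF) cx] cK] := bounds (x, y); lra.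
exists (vertex_conductance theta) => [f _|x]; first exact: expR_gt0.
have [k k_gt0 ->] := resistance_curvature_vertex e_sym e_irr theta x PS.
have := eq x; rewrite -inF; case: ifP => _.
  by move=> ->; rewrite mulr0 oppr0.
by rewrite oppr_gt0 pmulr_rlt0.
Qed.

(** Every edge has exactly one end at an odd position, so a spanning tree has
    average degree exactly 2 over the odd positions, whatever the weights. *)
Lemma snake_not_positive : odd (m * n) -> ~ resistance_positive R e.
Proof.
move=> omn [c [cpos curv]].
pose W := \sum_(S in spanning_trees e) tree_weight c S.
have wpos S : S \in spanning_trees e -> 0 < tree_weight c S.
  rewrite inE => /asboolP[Se _ _]; apply: prodr_gt0 => f fS.
  exact/cpos/(subsetP Se).
have S0 : exchanged_tree 0 1 0 \in spanning_trees e.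
  by apply: exchanged_tree_spanning => //; apply: snake_path.
have W_gt0 : 0 < W.
  rewrite /W (bigD1 (exchanged_tree 0 1 0)) //= ltr_wpDr ?wpos //.
  by apply: sumr_ge0 => S /andP[/wpos/ltW].
have : 0 < \sum_(x in odd_positions) resistance_curvature e c x.
  rewrite (bigD1 (v 1)) /=; last by rewrite inE vK.
  by rewrite ltr_pwDl // sumr_ge0 // => x _; exact/ltW.
suff -> : \sum_(x in odd_positions) resistance_curvature e c x = 0 by rewrite ltxx.
rewrite (eq_bigr _ (fun x _ => resistance_curvatureE e_sym e_irr x (lt0r_neq0 W_gt0))).
rewrite -mulr_suml exchange_big big1 ?mul0r // => S ST /=.
rewrite -mulr_sumr; have := sum_excess_odd_positions omn ST.
under eq_bigr do rewrite /degree_excess -opprB.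
by rewrite sumrN => /eqP; rewrite oppr_eq0 => /eqP ->; rewrite mulr0.
Qed.

End SnakeGraph.

(** * Boustrophedon order of the grid *)

(** The wave 0, 1, ..., w - 1, w - 1, ..., 1, 0, 0, 1, ... of period [2 * w]:
    in boustrophedon order a coordinate runs through this wave. *)
Definition zigzag (w x : nat) :=
  if odd (x %/ w) then w.-1 - x %% w else x %% w.

Lemma zigzag_lt w x : 0 < w -> zigzag w x < w.
Proof. by move=> w0; rewrite /zigzag; have := ltn_pmod x w0; case: odd; lia. Qed.

Lemma zigzag_small w x : x < w -> zigzag w x = x.
Proof. by move=> xw; rewrite /zigzag divn_small // modn_small. Qed.

Lemma zigzag_inj w x y : 0 < w -> x %/ w = y %/ w -> zigzag w x = zigzag w y ->
  x = y.
Proof.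
move=> w0 xy; rewrite /zigzag xy => E.
rewrite (divn_eq x w) (divn_eq y w) xy; congr (_ + _).
by move: E; have := ltn_pmod x w0; have := ltn_pmod y w0; case: odd; lia.
Qed.

Lemma zigzag_step w x : 0 < w -> ~~ (w %| x.+1) ->
  (zigzag w x).+1 = zigzag w x.+1 \/ (zigzag w x.+1).+1 = zigzag w x.
Proof.
move=> w0 ndiv; rewrite /zigzag divnS // (negbTE ndiv) add0n modnS (negbTE ndiv).
have := ltn_pmod x.+1 w0; rewrite modnS (negbTE ndiv).
by case: odd; [right|left]; lia.
Qed.

Lemma zigzag_mirror w x y t : 0 < w -> x + y + 1 = 2 * (w * t) ->
  zigzag w x = zigzag w y.
Proof.
move=> w0; have := ltn_pmod x w0.
rewrite {2}(divn_eq x w); set q := x %/ w; set r := x %% w => rw xy.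
have qt : q < 2 * t.
  rewrite ltnNge; apply/negP => le.
  have : 2 * t * w <= q * w by rewrite leq_mul2r le orbT.
  by rewrite -mulnA (mulnC t); lia.
have yE : y = (2 * t - q.+1) * w + (w.-1 - r).
  have : 2 * t * w = (2 * t - q.+1) * w + (q * w + w).
    by rewrite addnC -mulSnr -mulnDl subnKC.
  by rewrite -mulnA (mulnC t); lia.
have sw : w.-1 - r < w by lia.
rewrite /zigzag -/q -/r yE divnMDl // modnMDl divn_small // modn_small // addn0.
have -> : odd (2 * t - q.+1) = ~~ odd q by lia.
by case: odd => /=; lia.
Qed.

Lemma zigzag_turn w x : 0 < w -> w %| x.+1 -> zigzag w x = zigzag w x.+1.
Proof.
move=> w0 /dvdnP[q xq]; apply: (@zigzag_mirror w _ _ q) => //.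
by rewrite [w * q]mulnC -xq; lia.
Qed.

Lemma divn_mirror M x y : 0 < M -> M %| x + y + 1 ->
  x %/ M + y %/ M + 1 = (x + y + 1) %/ M.
Proof.
move=> M0 dv; have := ltn_pmod x M0; have := ltn_pmod y M0.
move: dv; rewrite {1 4}(divn_eq x M) {1 4}(divn_eq y M).
set r := x %% M; set s := y %% M; set a := _ %/ _; set b := y %/ M.
have -> : a * M + r + (b * M + s) + 1 = (a + b) * M + (r + s).+1 by rewrite mulnDl; lia.
rewrite dvdn_addr ?dvdn_mull // divnMDl // => /dvdnP[q rs] sM rM.
have q1 : q = 1.
  by case: q rs => [|[|q]] //; rewrite !mulSn; lia.
by rewrite rs q1 mul1n divnn M0.
Qed.

Section Boustrophedon.
Variables (d : nat) (n : 'I_d -> nat).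
Hypothesis n_gt0 : forall i, 0 < n i.

(** The number of points in the subgrid of the first [k] coordinates. *)
Definition volume k := \prod_(i < d | i < k) n i.

Lemma volume_gt0 k : 0 < volume k.
Proof. by apply: prodn_cond_gt0 => i _. Qed.

Lemma volumeS (i : 'I_d) : volume i.+1 = volume i * n i.
Proof.
rewrite /volume (bigD1 i) //= mulnC; congr (_ * _); apply: eq_bigl => j.
by rewrite ltnS (ltn_neqAle j) andbC.
Qed.

Lemma dvdn_volume k l : k <= l -> volume k %| volume l.
Proof.
move=> kl; rewrite /volume (bigID (fun i : 'I_d => i < k) (fun i : 'I_d => i < l)) /=.
apply: dvdn_mulr; rewrite (eq_bigl (fun i : 'I_d => (i < l) && (i < k))) // => i.
by case: (ltnP i k) => [ik|_]; rewrite ?andbT ?andbF // (leq_trans ik kl).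
Qed.

Lemma volume_full : volume d = \prod_i n i.
Proof. by apply: eq_bigl => i; rewrite ltn_ord. Qed.

Definition snake (p : nat) : {dffun forall i : 'I_d, 'I_(n i)} :=
  [ffun i : 'I_d => Ordinal (zigzag_lt (p %/ volume i) (n_gt0 i))].

Lemma snakeE p i : snake p i = zigzag (n i) (p %/ volume i) :> nat.
Proof. by rewrite ffunE. Qed.

(** The top coordinate is read off first: knowing the quotient by [volume k.+1]
    tells in which direction coordinate [k] runs. *)
Lemma snake_inj p q : p < volume d -> q < volume d -> snake p = snake q -> p = q.
Proof.
move=> pN qN E.
suff H k : k <= d -> p %/ volume (d - k) = q %/ volume (d - k).
  have := H d (leqnn d); rewrite subnn.
  have -> : volume 0 = 1 by rewrite /volume big_pred0.
  by rewrite !divn1.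
elim: k => [|k IHk] kd; first by rewrite subn0 !divn_small.
have kd' : d - k.+1 < d by lia.
have := IHk (ltnW kd); rewrite (_ : d - k = (Ordinal kd').+1) /=; last by lia.
rewrite (volumeS (Ordinal kd')) !divnMA => /zigzag_inj; apply => //.
by have := snakeE p (Ordinal kd'); rewrite E snakeE.
Qed.

Lemma grid_adj (x y : {dffun forall i : 'I_d, 'I_(n i)}) (i : 'I_d) :
  ((x i).+1 = y i :> nat \/ (y i).+1 = x i :> nat) ->
  (forall j, j != i -> x j = y j :> nat) -> grid n x y.
Proof.
move=> xyi xyj; apply/existsP; exists i; apply/andP; split.
  by apply/orP; case: xyi => ->; [left|right].
by apply/forallP => j; apply/implyP => /xyj/val_inj ->.
Qed.

(** Adding one to [p] moves the coordinate of the last digit reached by the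
    carry; the digits below it are at a turning point of their wave. *)
Lemma snake_grid_path p : p.+1 < volume d -> grid n (snake p) (snake p.+1).
Proof.
move=> pN.
have [k [vk vk1]] : exists k : 'I_d,
    volume k %| p.+1 /\ ~~ (volume k.+1 %| p.+1).
  have : ~~ (volume d %| p.+1) by apply/negP => /dvdn_leq; lia.
  suff H l : l <= d -> ~~ (volume l %| p.+1) -> exists k : 'I_d,
      volume k %| p.+1 /\ ~~ (volume k.+1 %| p.+1) by exact: H.
  elim: l => [|l IHl] ld.
    by rewrite /volume big_pred0 // dvd1n.
  have [dl|/IHl H _] := boolP (volume l %| p.+1); last exact/H/ltnW.
  by exists (Ordinal ld).
apply: (@grid_adj _ _ k).
  rewrite !snakeE divnS ?volume_gt0 // vk; apply: zigzag_step => //.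
  apply: contraNN vk1 => dv; rewrite volumeS -(divnK vk) [X in _ %| X]mulnC.
  by rewrite dvdn_pmul2l ?volume_gt0 // divnS ?volume_gt0 // vk.
move=> j jk; rewrite !snakeE divnS ?volume_gt0 //.
have [kj|] := ltnP k j.
  suff -> : volume j %| p.+1 = false by [].
  by apply: contraNF vk1; apply: dvdn_trans; exact: dvdn_volume.
rewrite leq_eqVlt (negbTE (jk : val j != val k)) => jk'.
have dj : volume j.+1 %| p.+1 by apply: dvdn_trans vk; exact: dvdn_volume.
have dj0 : volume j %| p.+1 by apply: dvdn_trans dj; exact: dvdn_volume.
rewrite dj0; apply: zigzag_turn => //.
rewrite -(dvdn_pmul2l (volume_gt0 j)) -volumeS.
suff <- : p.+1 = volume j * (p %/ volume j).+1 by [].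
by rewrite -{1}(divnK dj0) divnS ?volume_gt0 // dj0 mulnC.
Qed.

(** The two positions are mirror images about the turn between two layers of
    the last coordinate, and each of the other waves is symmetric about it. *)
Lemma snake_grid_chord (l : 'I_d) k i j : l.+1 = d ->
  snake_chord (volume l) (n l) k i j -> grid n (snake i) (snake j).
Proof.
move=> ld [kn ki ik ijk]; have vl := volume_gt0 l.
have vk : volume l * k.+1 = volume l * k + volume l by rewrite mulnS addnC.
have il : i %/ volume l = k.
  have -> : i = k * volume l + (i - volume l * k) by rewrite mulnC; lia.
  by rewrite divnMDl // divn_small ?addn0 //; lia.
have jl : j %/ volume l = k.+1.
  have -> : j = k.+1 * volume l + (j - volume l * k.+1) by rewrite mulnC; lia.
  by rewrite divnMDl // divn_small ?addn0 //; lia.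
apply: (@grid_adj _ _ l).
  by left; rewrite !snakeE il jl !zigzag_small // ltnW.
move=> t tNl; have tl : t < l.
  by rewrite ltn_neqAle (tNl : val t != val l) -ltnS ld ltn_ord.
rewrite !snakeE; have /dvdnP[c vc] : volume t.+1 %| volume l by exact: dvdn_volume.
have E : i + j + 1 = volume t * (2 * (n t * (c * k.+1))).
  by rewrite ijk vc volumeS; lia.
apply: (@zigzag_mirror _ _ _ (c * k.+1)) => //.
rewrite divn_mirror ?volume_gt0 ?E ?dvdn_mulr //.
by rewrite mulKn ?volume_gt0.
Qed.

Definition coordinate_sum (x : {dffun forall i : 'I_d, 'I_(n i)}) := \sum_i x i.

Lemma grid_odd_coordinate_sum x y :
  grid n x y -> odd (coordinate_sum x) != odd (coordinate_sum y).
Proof.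
move=> /existsP[i /andP[xyi /forallP xyj]].
rewrite /coordinate_sum (bigD1 i) // [in X in _ != X](bigD1 i) //=.
rewrite (eq_bigr (fun j => val (y j))) => [|j ji]; last first.
  by have /implyP/(_ ji)/eqP -> := xyj j.
by rewrite !oddD; case/orP: xyi => /eqP <- /=; case: odd; case: odd.
Qed.

Lemma odd_snake p : p < volume d -> odd (coordinate_sum (snake p)) = odd p.
Proof.
elim: p => [|p IHp] pN.
  rewrite /coordinate_sum big1 // => i _.
  by rewrite snakeE div0n zigzag_small.
have := grid_odd_coordinate_sum (snake_grid_path pN).
by rewrite IHp ?(ltnW pN) //=; case: odd; case: odd.
Qed.

Lemma card_grid : #|{dffun forall i : 'I_d, 'I_(n i)}| = volume d.
Proof.
rewrite card_dep_ffun foldrE big_map volume_full big_enum /=.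
by apply: eq_bigr => i _; rewrite card_ord.
Qed.

Lemma snake_surjective : exists pos : {dffun forall i : 'I_d, 'I_(n i)} -> nat,
  [/\ forall x, pos x < volume d, forall x, snake (pos x) = x
    & forall p, p < volume d -> pos (snake p) = p].
Proof.
have inj : injective (fun p : 'I_(volume d) => snake p).
  by move=> p q /snake_inj E; apply/val_inj/E.
have [|g gK Kg] := inj_card_bij inj; first by rewrite card_grid card_ord.
exists (fun x => val (g x)); split=> [x|x|p pN]; [exact: ltn_ord | exact: Kg |].
exact: (congr1 val (gK (Ordinal pN))).
Qed.

End Boustrophedon.

Theorem corollary4p8 (R : realType) (d : nat) (n : 'I_d -> nat)
    (hd : (2 <= d)%N) (hn : forall i : 'I_d, (2 <= n i)%N) :
  (~~ odd (\prod_(i < d) n i)%N -> resistance_positive R (grid n)) /\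
  (odd (\prod_(i < d) n i)%N -> strictly_resistance_nonnegative R (grid n)).
Proof.
have n_gt0 i : 0 < n i by apply: ltnW.
have l_lt : d.-1 < d by lia.
(* The rows are the layers of the last coordinate, each one traversed along
   the snake of the other coordinates. *)
pose l := Ordinal l_lt; have ld : l.+1 = d by rewrite /=; lia.
have NE : volume n d = volume n l * n l by rewrite -volumeS ld.
have m_gt1 : 1 < volume n l.
  have k_lt : d.-2 < d by lia.
  have lE : l = (Ordinal k_lt).+1 :> nat by rewrite /=; lia.
  rewrite lE volumeS; apply: leq_trans (hn (Ordinal k_lt)) _.
  by rewrite leq_pmull // volume_gt0.
have [pos [pos_lt posK vK]] := snake_surjective n_gt0.
have alternating x y : grid n x y -> odd (pos x) != odd (pos y).
  by move=> /grid_odd_coordinate_sum; rewrite -{1}(posK x) -{1}(posK y) !odd_snake.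
have chord k i j := @snake_grid_chord _ _ n_gt0 l k i j ld.
have path := snake_grid_path n_gt0.
rewrite -volume_full NE; rewrite NE in pos_lt vK path.
have [c cpos curv] := @snake_curvature R _ _ _ _ _ _ (@grid_sym d n)
  (@grid_irrefl d n) m_gt1 (hn l) pos_lt vK posK path chord alternating.
split=> parity; first by exists c; split=> // x; have := curv x; rewrite (negbTE parity).
split.
  exists c; split=> // x; have := curv x.
  by case: ifP => _ => [->|/ltW]; rewrite ?lexx.
exact: (snake_not_positive (@grid_sym d n) (@grid_irrefl d n) m_gt1 (hn l)
  pos_lt vK posK path alternating parity).
Qed.
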